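(* Let $G=(V,w,m)$ be a locally finite weighted graph. For all $x,y\in V$ with $x\sim y$, $$K_1^{Ol}(x,y)\ge K_1(x,y).$$
   Context: A weighted graph $G=(V,w,m)$ consists of a vertex set $V$, symmetric edge weights $w:V\times V\to[0,\infty)$ and a vertex measure $m:V\to(0,\infty)$; $x\sim y$ (an edge, $x\neq y$) iff $w(x,y)>0$. Locally finite means every vertex has finitely many neighbors. Simple graphs are the case $w\in\{0,1\}$, $m\equiv1$. $d$ is the combinatorial (path) distance. $\Delta f(x)=\frac1{m(x)}\sum_y w(x,y)(f(y)-f(x))$, $|\nabla_1 f|(x)=\max_{d(x,y)\le 1}|f(y)-f(x)|$, $\|\nabla_1f\|_\infty=\sup_x|\nabla_1f|(x)$. Classical Ollivier curvature of an edge $x\sim y$: $$K_1^{Ol}(x,y)=\min\{\Delta f(x)-\Delta f(y)\;:\;f:V\to\mathbb{R},\ \|\nabla_1f\|_\infty=1,\ f(y)-f(x)=1\}.$$ Gradient-Ollivier curvature with $R=1$: $$K_1(x,y)=\inf\big\{\Delta|\nabla_1 f|(x)-(\Delta f(y)-\Delta f(x))\,\mathrm{sgn}(f(y)-f(x))\big\},$$ over all $f:V\to\mathbb{R}$ with $|\nabla_1f|(x)=1$ and $|f(y)-f(x)|=|\nabla_1 f|(x)$. *)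

(* Defs.v *)
From HB Require Import structures.
From mathcomp Require Import all_boot all_order all_algebra.
From mathcomp Require Import all_classical all_reals all_analysis.

Set Implicit Arguments.
Unset Strict Implicit.
Unset Printing Implicit Defensive.

Import Order.TTheory GRing.Theory Num.Theory.
Import numFieldNormedType.Exports.

Local Open Scope classical_set_scope.
Local Open Scope ring_scope.

(* The diagonal weights are unconstrained: they enter neither [adj] nor
   [laplacian]. *)
Record wgraph (R : realType) (V : choiceType) := WGraph {
  weight : V -> V -> R;
  vmeas : V -> R;
  weight_sym : forall x y, weight x y = weight y x;
  weight_ge0 : forall x y, 0 <= weight x y;
  vmeas_gt0 : forall x, 0 < vmeas x }.

Section WeightedGraph.
Context {R : realType} {V : choiceType}.
Variable G : wgraph R V.

Definition adj : rel V := fun x y => (x != y) && (0 < weight G x y).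

Definition locally_finite : Prop := forall x, finite_set [set y | adj x y].

(* Equal to +oo when no path joins x to y; G need not be connected. *)
Definition gdist (x y : V) : \bar R :=
  ereal_inf [set (size p)%:R%:E | p in [set p | path adj x p /\ last x p = y]].

(* The sum over the whole of V has finite support when G is locally finite,
   since its term at y = x vanishes. *)
Definition laplacian (f : V -> R) (x : V) : R :=
  (vmeas G x)^-1 * \sum_(y \in [set: V]) weight G x y * (f y - f x).

(* When G is locally finite the ball is finite and contains x, so this
   supremum is a maximum. *)
Definition grad1 (f : V -> R) (x : V) : R :=
  sup [set `|f y - f x| | y in [set y | (gdist x y <= 1)%E]].

Definition grad1_norm (f : V -> R) : \bar R :=
  ereal_sup [set (grad1 f x)%:E | x in [set: V]].

(* Both curvatures are infima in the extended reals.  The first one is attained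
   on the edges of a locally finite graph; the second one may be -oo. *)
Definition ollivier_curv (x y : V) : \bar R :=
  ereal_inf [set (laplacian f x - laplacian f y)%:E
            | f in [set f | grad1_norm f = 1%E /\ f y - f x = 1]].

Definition grad_ollivier_curv (x y : V) : \bar R :=
  ereal_inf [set (laplacian (grad1 f) x
                  - (laplacian f y - laplacian f x) * Num.sg (f y - f x))%:E
            | f in [set f | grad1 f x = 1 /\ `|f y - f x| = grad1 f x]].

End WeightedGraph.

(* Main.v *)
(* A test function f for the classical curvature satisfies |grad f| <= 1
   everywhere, with equality at x because |f y - f x| = 1.  So |grad f| is
   maximal at x, its laplacian there is nonpositive, and f is a test function
   for the gradient curvature with a value that is no larger. *)
Require Import Defs.
From HB Require Import structures.
From mathcomp Require Import all_boot all_order all_algebra.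
From mathcomp Require Import all_classical all_reals all_analysis.

Set Implicit Arguments.
Unset Strict Implicit.
Unset Printing Implicit Defensive.

Import Order.TTheory GRing.Theory Num.Theory.

Local Open Scope ring_scope.

Section Gradient.
Local Open Scope classical_set_scope.
Context {R : realType} {V : choiceType}.
Variable G : wgraph R V.

Lemma gdist_le1 (x y : V) : (gdist G x y <= 1)%E <-> y = x \/ adj G x y.
Proof.
split=> [dxy|xy]; last first.
  apply: ge_ereal_inf; case: xy => [->|xy].
    by exists 0%E; rewrite ?lee01//; exists [::].
  by exists 1%E => //; exists [:: y] => //=; rewrite xy.
apply: contrapT => /not_orP[yx nxy]; move: dxy; apply/negP; rewrite -ltNge.
(* A path of length 0 forces [y = x] and one of length 1 forces [adj x y], so all remaining paths
   have length at least 2. *)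
apply: (@lt_le_trans _ _ 2%:R%:E); first by rewrite lte_fin ltr1n.
apply: le_ereal_inf_tmp => _ [p [px pl] <-]; rewrite lee_fin ler_nat.
case: p px pl => [_ /esym//|z [|//]] /=.
by rewrite andbT => xz zy; move: nxy; rewrite -zy.
Qed.

Hypothesis hG : locally_finite G.

(** Local finiteness makes the unit ball finite, so the real [sup] in [grad1] is over a bounded set
    and is a genuine upper bound. *)
Lemma grad1_ge (f : V -> R) (x y : V) : adj G x y ->
  `|f y - f x| <= grad1 G f x.
Proof.
move=> xy; apply: ub_le_sup; last by exists y => //; apply/gdist_le1; right.
have : finite_set [set y | (gdist G x y <= 1)%E].
  rewrite [X in finite_set X](_ : _ = [set x] `|` [set y | adj G x y]).
    by rewrite finite_setU; split.
  by apply/seteqP; split=> z /gdist_le1.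
(* The sum of these nonnegative terms dominates each of them. *)
case/finite_seqP => s ->; exists (\sum_(z <- s) `|f z - f x|) => _ [z /= zs <-].
by rewrite (big_rem z)//= lerDl sumr_ge0.
Qed.

End Gradient.

Lemma laplacian_le0 (R : realType) (V : choiceType) (G : wgraph R V)
    (f : V -> R) (x : V) :
  (forall z, f z <= f x) -> laplacian G f x <= 0.
Proof.
move=> fx; rewrite /laplacian pmulr_rle0 ?invr_gt0 ?vmeas_gt0//.
by apply: fsumr_le0 => z _; rewrite mulr_ge0_le0 ?weight_ge0 ?subr_le0.
Qed.

Theorem theorem1p3 (R : realType) (V : choiceType) (G : wgraph R V)
    (hG : locally_finite G) (x y : V) (hxy : adj G x y) :
  (ollivier_curv G x y >= grad_ollivier_curv G x y)%E.
Proof.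
apply: le_ereal_inf_tmp => _ [f [f1 fxy] <-].
have grad_le1 z : grad1 G f z <= 1.
  by rewrite -lee_fin -f1; apply: ereal_sup_ubound; exists z.
have gradx : grad1 G f x = 1.
  apply/eqP; rewrite eq_le grad_le1/=.
  by apply: le_trans (grad1_ge hG f hxy); rewrite fxy normr1.
apply: ge_ereal_inf.
exists (laplacian G (grad1 G f) x
        - (laplacian G f y - laplacian G f x) * Num.sg (f y - f x))%:E.
  by exists f => //; split=> //; rewrite fxy normr1 gradx.
(* The sign is 1, so the two values differ exactly by the laplacian of [grad1 G f] at its maximum
   [x]. *)
rewrite lee_fin fxy sgr1 mulr1 opprB gerDr laplacian_le0// => z.
by rewrite gradx.
Qed.
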